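(* Let $H_1, \dots ,H_t$ be graphs such that each $H_i$ is $(\alpha_i, A_i, \eta_i)$-Erdős–Simonovits good (with $0\le\alpha_i<1$). Fix an edge $f_i$ in each $H_i$, and let $\mathcal{H}$ be the set of all graphs formed by gluing the $H_i$'s along the $f_i$'s. Let $\alpha = \max_{1\leq i \leq t}\alpha_i$. Then $$\mathrm{ex}(n, \mathcal{H}) = O(n^{1 + \alpha}).$$ Moreover, if $|\mathcal{H}| = 1$, then the unique graph in $\mathcal{H}$ is $(\alpha,A, \eta)$-Erdős–Simonovits good for some constants $A, \eta>0$.
   Context: A graph $H$ is $(\alpha, A, \eta)$-Erdős–Simonovits good if every $n$-vertex graph $G$ with $pn^2\geq An^{1 + \alpha}$ edges contains at least $\eta p^{\mathrm{e}(H)}n^{v(H)}$ copies of $H$. Gluing the $H_i$ along the $f_i$: take the vertex-disjoint union of the $H_i$ and identify all the edges $f_i$ into one edge, choosing for each $i$ one of the two ways of matching the endpoints of $f_i$ to the two endpoints of the common edge; $\mathcal{H}$ is the set of all graphs arising from all such choices. $\mathrm{ex}(n,\mathcal{H})$ is the maximum number of edges in an $n$-vertex graph containing no member of $\mathcal{H}$. *)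

(* Defs.v *)
From HB Require Import structures.
From mathcomp Require Import all_boot all_order all_algebra.
From mathcomp Require Import reals exp.
Set Implicit Arguments. Unset Strict Implicit. Unset Printing Implicit Defensive.
Import Order.TTheory GRing.Theory Num.Theory.

Record graph := Graph { vtx : finType; adj : rel vtx }.

Definition simple_graph (G : graph) : Prop :=
  (forall x : vtx G, ~~ adj x x) /\ (forall x y : vtx G, adj x y = adj y x).

(* v(G) and e(G) (each undirected edge counted once: half the ordered adjacent pairs). *)
Definition nverts (G : graph) : nat := #|vtx G|.
Definition nedges (G : graph) : nat :=
  (#|[set p : vtx G * vtx G | adj p.1 p.2]|)./2.

Definition copies (H G : graph) : nat :=
  #|[set f : {ffun vtx H -> vtx G} |
      injectiveb f && [forall x : vtx H, forall y : vtx H, adj x y ==> adj (f x) (f y)]]|.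

Definition contains (G H : graph) : bool := 0 < copies H G.

Local Open Scope ring_scope.
Definition ES_good (R : realType) (alpha A eta : R) (H : graph) : Prop :=
  forall G : graph, simple_graph G ->
    let n := nverts G in
    let p : R := (nedges G)%:R / (n ^ 2)%:R in
    p * (n%:R) ^+ 2 >= A * powR (n%:R) (1 + alpha) ->
    (copies H G)%:R >= eta * p ^+ (nedges H) * (n%:R) ^+ (nverts H).

(* Gluing H_0..H_{t-1} along the edges f_i = (a i, b i).  The common edge has
   endpoints ord0, ord_max of 'I_2; sigma i chooses which of the two ways the
   endpoints of f_i are matched to them. *)
Section Glue.
Variables (t : nat) (H : 'I_t -> graph) (a b : forall i, vtx (H i)).

Definition glue_vtx : finType :=
  ('I_2 + {i : 'I_t & {v : vtx (H i) | (v != a i) && (v != b i)}})%type.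

Definition glue_map (sigma : 'I_t -> bool) (i : 'I_t) (v : vtx (H i)) : glue_vtx :=
  match @idP ((v != a i) && (v != b i)) with
  | ReflectT h => inr (Tagged (fun j => {w : vtx (H j) | (w != a j) && (w != b j)})
                              (exist (fun w => (w != a i) && (w != b i)) v h))
  | ReflectF _ =>
      if v == a i then inl (if sigma i then ord_max else ord0)
      else inl (if sigma i then ord0 else ord_max)
  end.

Definition glue_adj (sigma : 'I_t -> bool) : rel glue_vtx :=
  fun u w => [exists i : 'I_t, [exists x : vtx (H i), [exists y : vtx (H i),
      [&& @adj (H i) x y, glue_map sigma x == u & glue_map sigma y == w]]]].

Definition glue (sigma : 'I_t -> bool) : graph := Graph (glue_adj sigma).
End Glue.

Definition isomorphic (G1 G2 : graph) : Prop :=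
  exists f : vtx G1 -> vtx G2, bijective f /\ forall x y : vtx G1, adj (f x) (f y) = adj x y.

Definition graph_of_rel (n : nat) (E : {ffun 'I_n * 'I_n -> bool}) : graph :=
  @Graph 'I_n (fun x y => E (x, y)).

Definition ex_glue (t : nat) (H : 'I_t -> graph) (a b : forall i, vtx (H i)) (n : nat) : nat :=
  \max_(E : {ffun 'I_n * 'I_n -> bool} |
          [forall x, ~~ E (x, x)] && [forall x, forall y, E (x, y) == E (y, x)] &&
          [forall sigma : {ffun 'I_t -> bool},
             ~~ contains (graph_of_rel E) (glue a b sigma)])
     nedges (graph_of_rel E).

(* Main.v *)
Require Import Defs.
From HB Require Import structures.
From mathcomp Require Import all_boot all_order all_algebra.
From mathcomp Require Import reals exp.
From mathcomp Require Import zify ring lra.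
Import Order.TTheory GRing.Theory Num.Theory.
Set Implicit Arguments. Unset Strict Implicit. Unset Printing Implicit Defensive.

(** Fix a host graph with edge set [D] and [n] vertices.  If [H] is good, most edges of
    [D] carry many copies of [H] rooted at [f]: otherwise the poor edges would form a
    dense graph, whose copies of [H] would have to be rooted at poor edges.  Choosing a
    random vertex set [W] and keeping the edges that avoid [W] while many of their rooted
    copies have all other vertices in [W], one obtains [D'] with a positive proportion of
    the edges of [D].  Iterating over [H_1, ..., H_t] gives [D_0 > D_1 > ... > D_t] and
    [W_1, ..., W_t]; copies of the [H_i] rooted at a common edge of [D_t], found in
    [D_(i-1)] with interior in [W_i], are disjoint outside that edge, because later copies
    live in graphs avoiding the earlier [W_i].  Only isolated vertices of the [H_i] may
    still collide, and these can be re-embedded freely.  Summing over the orientations of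
    the [f_i] yields a lower bound for the total number of copies of all glued graphs. *)

(** * Embeddings into an edge set and copies rooted at an edge *)

Section Embeddings.
Variables (H : graph) (V : finType).

Definition embeddings (D : {set V * V}) : {set {ffun vtx H -> V}} :=
  [set f : {ffun vtx H -> V} | injectiveb f &&
     [forall x : vtx H, forall y : vtx H, adj x y ==> ((f x, f y) \in D)]].

Definition rooted (a b : vtx H) (D : {set V * V}) (W : {set V}) (u v : V) :
    {set {ffun vtx H -> V}} :=
  [set f in embeddings D | [&& f a == u, f b == v &
     [forall x, (x != a) && (x != b) ==> (f x \in W)]]].

Lemma embeddingsP (D : {set V * V}) (f : {ffun vtx H -> V}) :
  reflect (injective f /\ forall x y, adj x y -> (f x, f y) \in D)
          (f \in embeddings D).
Proof.
rewrite inE; apply: (iffP andP) => -[].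
  move=> /injectiveP inj_f /forallP hom_f; split=> // x y xy.
  by move/forallP: (hom_f x) => /(_ y) /implyP; apply.
move=> inj_f hom_f; split; first exact/injectiveP.
by apply/forallP => x; apply/forallP => y; apply/implyP; apply: hom_f.
Qed.

Lemma rootedP a b (D : {set V * V}) (W : {set V}) u v (f : {ffun vtx H -> V}) :
  reflect [/\ f \in embeddings D, f a = u, f b = v &
              forall x, x != a -> x != b -> f x \in W]
          (f \in rooted a b D W u v).
Proof.
rewrite [X in reflect _ X]inE; apply: (iffP andP) => [[Df /and3P[/eqP fa /eqP fb /forallP fW]]|].
  by split=> // x xa xb; apply: (implyP (fW x)); rewrite xa.
move=> [Df fa fb fW]; split=> //; rewrite fa fb !eqxx /=.
by apply/forallP => x; apply/implyP => /andP[]; apply: fW.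
Qed.

Lemma card_embeddings_rooted a b (D : {set V * V}) : adj a b ->
  #|embeddings D| = \sum_(e in D) #|rooted a b D setT e.1 e.2|.
Proof.
move=> ab; rewrite -sum1_card.
rewrite (partition_big (fun f : {ffun vtx H -> V} => (f a, f b)) (mem D)) /=.
  apply: eq_bigr => -[u v] _; rewrite -sum1_card; apply: eq_bigl => f /=.
  apply/andP/rootedP => [[Df /eqP[<- <-]]|[Df fa fb _]]; last by rewrite Df fa fb.
  by split=> // x _ _; rewrite inE.
by move=> f /embeddingsP[_]; apply.
Qed.

Lemma rooted_mono a b (D D' : {set V * V}) (W W' : {set V}) u v : D \subset D' -> W \subset W' ->
  rooted a b D W u v \subset rooted a b D' W' u v.
Proof.
move=> sD sW; apply/subsetP => f /rootedP[/embeddingsP[inj_f hom_f] fa fb fW].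
apply/rootedP; split=> //; last by move=> x xa xb; apply: (subsetP sW); apply: fW.
by apply/embeddingsP; split=> // x y xy; apply: (subsetP sD); apply: hom_f.
Qed.

End Embeddings.

(** * Random vertex subsets *)

Lemma card_sets (V : finType) : #|{set V}| = 2 ^ #|V|.
Proof. by rewrite -(cardsT V) -card_powerset powersetT cardsT. Qed.

(** The map [Z |-> Z :|: S] injects the subsets of the complement of [S :|: T] into the sets counted
    on the right. *)
Lemma card_separating_sets (V : finType) (S T : {set V}) : [disjoint S & T] ->
  2 ^ #|V| <=
  2 ^ #|S :|: T| * #|[set W : {set V} | (S \subset W) && [disjoint T & W]]|.
Proof.
move=> dST; rewrite -(cardsC (S :|: T)) expnD leq_mul2l; apply/orP; right.
rewrite -card_powerset.
rewrite -(@card_in_imset _ _ (fun Z => Z :|: S) (powerset (~: (S :|: T)))).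
  apply/subset_leq_card/subsetP => W /imsetP[Z sZ ->].
  rewrite powersetE in sZ.
  rewrite inE subsetUr /= disjoint_sym disjoints_subset subUset -disjoints_subset.
  rewrite -[S \subset _]disjoints_subset dST andbT disjoints_subset.
  by apply: subset_trans sZ _; rewrite setCS subsetUr.
have aux (Z : {set V}) : Z \in powerset (~: (S :|: T)) -> (Z :|: S) :\: S = Z.
  rewrite inE => sZ; rewrite setDUl setDv setU0; apply/setDidPl.
  by rewrite disjoints_subset (subset_trans sZ) // setCS subsetUl.
by move=> Z Z' /aux eZ /aux eZ' e; rewrite -eZ -eZ' e.
Qed.

Section RandomSubset.
Variables (H : graph) (V : finType) (a b : vtx H) (D : {set V * V}).
Hypothesis nab : a != b.

Let avoid (u v : V) : pred {set V} := fun W => (u \notin W) && (v \notin W).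

(** Exchange the sums over [W] and [f]. For a fixed [f], a random [W] contains the image of the
    interior and misses the images of both roots with probability at least [2 ^- #|vtx H|], as these
    are disjoint sets making up the image of [f]. *)
Lemma sum_rooted_avoid u v :
  2 ^ #|V| * #|rooted a b D setT u v| <=
  2 ^ #|vtx H| * \sum_(W : {set V} | avoid u v W) #|rooted a b D W u v|.
Proof.
have -> : \sum_(W : {set V} | avoid u v W) #|rooted a b D W u v| =
  \sum_(f in rooted a b D setT u v)
     #|[set W : {set V} | avoid u v W && (f \in rooted a b D W u v)]|.
  transitivity (\sum_(W : {set V} | avoid u v W) \sum_(f in rooted a b D W u v) 1).
    by apply: eq_bigr => W _; rewrite sum1_card.
  rewrite (exchange_big_dep (mem (rooted a b D setT u v))) /=; last first.
    by move=> W f _; apply/subsetP/rooted_mono => //; apply: subsetT.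
  by apply: eq_bigr => f _; rewrite -sum1_card; apply: eq_bigl => W; rewrite inE.
rewrite -sum1_card !big_distrr /=; apply: leq_sum => f fr; rewrite muln1.
have /rootedP[/[dup] Df /embeddingsP[inj_f _] fa fb _] := fr.
pose S := f @: (~: [set a; b]); pose T := f @: [set a; b].
have dST : [disjoint S & T].
  rewrite -setI_eq0 -imsetI; last by move=> x y _ _; apply: inj_f.
  by rewrite setIC setICr imset0.
apply: leq_trans (card_separating_sets dST) _; apply: leq_mul.
  rewrite -imsetU setUC setUCr card_imset // cardsT //.
apply/subset_leq_card/subsetP => W; rewrite !inE => /andP[sW dW].
have nW x : x \in T -> x \notin W by move=> xT; rewrite (disjointFr dW).
rewrite /avoid -fa -fb !nW ?imset_f ?inE ?eqxx ?orbT //=.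
apply/andP; split; first by move: Df; rewrite inE.
by apply/forallP => x; apply/implyP => xab; apply/(subsetP sW)/imset_f; rewrite !inE negb_or.
Qed.

(** Counting both orientations makes the number symmetric in [e], which keeps the thinned edge set
    symmetric. *)
Definition both_rooted (W : {set V}) (e : V * V) : nat :=
  #|rooted a b D W e.1 e.2| + #|rooted a b D W e.2 e.1|.

(** The [.+1] halves the mean proportion [2 ^- #|vtx H|]; this is the slack consumed by the reverse
    Markov argument. *)
Definition rich (W : {set V}) (e : V * V) : bool :=
  avoid e.1 e.2 W && (both_rooted setT e <= 2 ^ #|vtx H|.+1 * both_rooted W e).

(* Reverse Markov: [both_rooted W e] has mean at least a [2 ^- #|vtx H|] proportion
   of its maximum [both_rooted setT e]. *)
Lemma many_rich_sets e : 0 < both_rooted setT e ->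
  2 ^ #|V| <= 2 ^ #|vtx H|.+1 * #|[set W | rich W e]|.
Proof.
move=> Y0; set Y := both_rooted setT e; set h := 2 ^ #|vtx H|.+1.
have YW W : both_rooted W e <= Y.
  by apply: leq_add; apply: subset_leq_card; apply: rooted_mono (subsetT _).
have lb : 2 ^ #|V| * Y <= 2 ^ #|vtx H| * \sum_(W : {set V} | avoid e.1 e.2 W) both_rooted W e.
  rewrite /Y /both_rooted big_split /= !mulnDr leq_add ?sum_rooted_avoid //.
  have avC : avoid e.2 e.1 =1 avoid e.1 e.2 by move=> W; rewrite /avoid andbC.
  by rewrite -(eq_bigl _ _ avC) sum_rooted_avoid.
(* A rich [W] contributes at most [Y], any other avoiding [W] less than [Y / h]. *)
have ub : h * (\sum_(W : {set V} | avoid e.1 e.2 W) both_rooted W e) <=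
          h * (#|[set W | rich W e]| * Y) + 2 ^ #|V| * Y.
  rewrite (bigID (fun W => rich W e)) /= mulnDr leq_add //.
    rewrite leq_mul2l; apply/orP; right; rewrite -sum_nat_const.
    rewrite [leqLHS](eq_bigl [in [set W | rich W e]]); first exact: leq_sum.
    by move=> W; rewrite !inE /rich; case: (avoid _ _ _).
  rewrite big_distrr /=.
  apply: (@leq_trans (\sum_(W : {set V}) Y)); last first.
    by rewrite sum_nat_const card_sets.
  rewrite big_mkcond /=; apply: leq_sum => W _; case: ifP => // /andP[aW].
  by rewrite /rich aW /= -ltnNge => /ltnW.
move: lb ub; rewrite /h expnS -/Y => lb ub.
rewrite -(leq_pmul2r Y0); nia.
Qed.

(** Averaging over [W]: if every [W] failed, double counting the pairs [(W, e)] with [rich W e]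
    would contradict [many_rich_sets]. *)
Lemma exists_rich_subset (E : {set V * V}) :
  (forall e, e \in E -> 0 < both_rooted setT e) ->
  exists W, #|E| <= 2 ^ #|vtx H|.+1 * #|[set e in E | rich W e]|.
Proof.
move=> E0; have [/existsP//|] := boolP [exists W : {set V},
  #|E| <= 2 ^ #|vtx H|.+1 * #|[set e in E | rich W e]|].
rewrite negb_exists => /forallP lt.
have dc : \sum_(W : {set V}) #|[set e in E | rich W e]| =
          \sum_(e in E) #|[set W | rich W e]|.
  transitivity (\sum_(W : {set V}) \sum_(e in E) if rich W e then 1 else 0).
    by apply: eq_bigr => W _; rewrite -sum1dep_card big_mkcondr.
  rewrite exchange_big /=; apply: eq_bigr => e _.
  by rewrite -big_mkcond /= sum1dep_card.
have l1 : 2 ^ #|V| * #|E| <= 2 ^ #|vtx H|.+1 * \sum_(W : {set V}) #|[set e in E | rich W e]|.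
  rewrite dc mulnC -sum_nat_const big_distrr; apply: leq_sum => e eE.
  exact/many_rich_sets/E0.
have l2 : 2 ^ #|vtx H|.+1 * \sum_(W : {set V}) #|[set e in E | rich W e]| < 2 ^ #|V| * #|E|.
  have -> : 2 ^ #|V| * #|E| = \sum_(W : {set V}) #|E|.
    by rewrite sum_nat_const card_sets.
  (* One strict summand makes the sum strict; [set0] is a subset that always exists. *)
  rewrite big_distrr /= (bigD1 set0) //= [ltnRHS](bigD1 set0) //= -addSn.
  rewrite leq_add //; first by rewrite ltnNge lt.
  by apply: leq_sum => W _; rewrite ltnW // ltnNge lt.
by move: (leq_ltn_trans l1 l2); rewrite ltnn.
Qed.

End RandomSubset.

(** * Symmetric edge sets and simple graphs *)

Definition edge_set (V : finType) (D : {set V * V}) : Prop :=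
  (forall x y, (x, y) \in D -> (y, x) \in D) /\ (forall x, (x, x) \notin D).

(** A nonempty [D] has at least two elements, and from there on the factor 3 absorbs the rounding,
    with no parity argument. *)
Lemma card_edge_set_half (V : finType) (D : {set V * V}) :
  edge_set D -> #|D| <= 3 * #|D|./2.
Proof.
move=> [symD irrD]; have [->|[[x y] xyD]] := set_0Vmem D; first by rewrite cards0.
have : #|[set (x, y); (y, x)]| <= #|D|.
  apply/subset_leq_card/subsetP => e; rewrite !inE => /orP[]/eqP-> //.
  exact: symD.
rewrite cards2 xpair_eqE; case: eqVneq => [xy|_] /=; last lia.
by move: xyD; rewrite xy (negPf (irrD _)).
Qed.

Lemma both_rootedC (H : graph) (V : finType) (a b : vtx H) D W (x y : V) :
  both_rooted a b D W (x, y) = both_rooted a b D W (y, x).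
Proof. by rewrite /both_rooted addnC. Qed.

Lemma simple_edge_neq (H : graph) (a b : vtx H) :
  simple_graph H -> adj a b -> a != b.
Proof. by case=> irr _; case: eqVneq => // ->; rewrite (negPf (irr b)). Qed.

Lemma simple_edge_nverts (H : graph) (a b : vtx H) :
  simple_graph H -> adj a b -> 1 < nverts H.
Proof.
move=> sH ab; rewrite /nverts -cardsT; have := subset_leq_card (subsetT [set a; b]).
by rewrite cards2 (simple_edge_neq sH ab).
Qed.

Lemma simple_edge_nedges (H : graph) (a b : vtx H) :
  simple_graph H -> adj a b -> 0 < nedges H.
Proof.
move=> sH ab; have nab := simple_edge_neq sH ab.
have : #|[set (a, b); (b, a)]| <= #|[set p : vtx H * vtx H | adj p.1 p.2]|.
  apply/subset_leq_card/subsetP => e; rewrite !inE => /orP[]/eqP-> //=.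
  by case: sH => _ <-.
by rewrite cards2 xpair_eqE (negPf nab) /nedges /=; set N := #|_|; lia.
Qed.

Local Open Scope ring_scope.

(** * Many edges with many rooted copies *)

Lemma ES_good_embeddings (R : realType) (al A eta : R) (H : graph)
    (V : finType) (D : {set V * V}) :
  ES_good al A eta H -> edge_set D -> (0 < #|V|)%N ->
  A * powR #|V|%:R (1 + al) <= (#|D|./2)%:R ->
  eta * ((#|D|./2)%:R / #|V|%:R ^+ 2) ^+ nedges H * #|V|%:R ^+ nverts H
    <= #|embeddings H D|%:R.
Proof.
move=> good [symD irrD] V0 le.
pose G := Graph (fun x y => (x, y) \in D).
have eG : nedges G = #|D|./2.
  by rewrite /nedges; congr (#|pred_of_set _|./2); apply/setP => -[x y]; rewrite inE.
have sG : simple_graph G.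
  by split=> [x|x y] /=; [exact: irrD|apply/idP/idP; exact: symD].
have := good G sG; rewrite /= eG /nverts /= natrX; apply.
by rewrite divfK // expf_neq0 // pnatr_eq0 -lt0n.
Qed.

(** One thinning step. The exponents are those of the mean number of copies per edge,
    [p ^ e * n ^ v] divided by [p * n ^ 2]. The 6 in the density hypothesis is a 2 for passing to
    half of [D] times the 3 of [card_edge_set_half]. *)
Lemma rooted_robust (R : realType) (al A eta : R) (H : graph) (a b : vtx H) :
  simple_graph H -> adj a b -> 0 < eta -> ES_good al A eta H ->
  exists2 c : R, 0 < c & forall (V : finType) (D : {set V * V}),
    edge_set D -> 6 * A * powR #|V|%:R (1 + al) <= #|D|%:R ->
  exists (W : {set V}) (D' : {set V * V}),
  [/\ D' \subset D, edge_set D',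
      forall e, e \in D' -> (e.1 \notin W) && (e.2 \notin W),
      c * #|D|%:R <= #|D'|%:R &
      forall e, e \in D' ->
        c * (#|D|%:R / #|V|%:R ^+ 2) ^+ (nedges H).-1 * #|V|%:R ^+ (nverts H - 2)
          <= (both_rooted a b D W e)%:R].
Proof.
move=> sH ab eta0 good.
pose h : R := (2 ^ #|vtx H|.+1)%:R.
have h1 : 1 <= h by rewrite ler1n expn_gt0.
have h0 : 0 < h by lra.
(* The poor edges, if they were a majority, would have density at least [p / 6]; the final 2 leaves
   room for a contradiction. *)
pose c1 : R := eta / 6 ^+ nedges H / 2.
have c10 : 0 < c1 by rewrite !divr_gt0 // exprn_gt0.
have c12 : 2 * c1 = eta / 6 ^+ nedges H by rewrite /c1 mulrC divfK // pnatr_eq0.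
(* Half of [D] passes the threshold and a suitable [W] keeps a [1 / h] share of it; richness costs
   another [h] in the number of rooted copies. *)
pose c := Num.min (1 / (2 * h)) (c1 / h).
have c0 : 0 < c by rewrite lt_min; apply/andP; split; apply: divr_gt0 => //; apply: mulr_gt0.
have cl1 : c <= 1 / (2 * h) by rewrite ge_min lexx.
have cl2 : c <= c1 / h by rewrite ge_min lexx orbT.
exists c => // V D eD leD.
have [D0|[[u0 v0] uvD]] := set_0Vmem D.
  exists set0, set0; rewrite D0 sub0set cards0 mulr0; split=> //.
  - by split=> [x y|x]; rewrite inE.
  - by move=> e; rewrite inE.
  - by move=> e; rewrite inE.
have V0 : (0 < #|V|)%N by apply/card_gt0P; exists u0.
set n : R := #|V|%:R; set M : R := #|D|%:R.
have n0 : 0 < n by rewrite ltr0n.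
have M0 : 0 < M by rewrite ltr0n; apply/card_gt0P; exists (u0, v0).
have e0 := simple_edge_nedges sH ab; have v1 := simple_edge_nverts sH ab.
set p : R := M / n ^+ 2.
have p0 : 0 < p by rewrite divr_gt0 // exprn_gt0.
have pE : p = M / n ^+ 2 by []; clearbody p.
pose th : R := c1 * p ^+ (nedges H).-1 * n ^+ (nverts H - 2).
have th0 : 0 < th by do 2?[apply: mulr_gt0]; rewrite ?exprn_gt0.
have Mth : M * th = c1 * p ^+ nedges H * n ^+ nverts H.
  rewrite /th -[X in _ = _ * p ^+ X * _](prednK e0) exprS.
  rewrite -[X in _ = _ * n ^+ X](subnK v1) exprD pE.
  by field; rewrite gt_eqF.
pose Y e := both_rooted a b D setT e.
pose E := [set e in D | th <= (Y e)%:R].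
pose B := D :\: E.
have eE : edge_set E.
  split=> [x y|x]; rewrite !inE; last by rewrite (negPf (eD.2 x)).
  by case/andP => xyD; rewrite /Y both_rootedC => ->; rewrite (eD.1 _ _ xyD).
have eB : edge_set B.
  split=> [x y|x]; rewrite !inE; last by rewrite (negPf (eD.2 x)) andbF.
  case/andP=> + xyD; rewrite xyD (eD.1 _ _ xyD) /= /Y both_rootedC.
  by move=> ->.
have sED : E \subset D by apply/subsetP => e; rewrite inE => /andP[].
have DEB : M = #|E|%:R + #|B|%:R.
  by rewrite -natrD /M -(cardsID E D) (setIidPr sED).
(* Otherwise more than half of the edges lie in [B], and goodness gives at least [2 * (M * th)]
   embeddings into [B]. Each is rooted at a poor edge, so there are at most [#|B| * th] of them. *)
have Ebig : M <= 2 * #|E|%:R.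
  rewrite leNgt; apply/negP => ltE.
  have Bbig : M < 2 * #|B|%:R by lra.
  have m_B : M <= 6 * (#|B|./2)%:R.
    have := card_edge_set_half eB; rewrite -(ler_nat R) natrM; lra.
  have := ES_good_embeddings good eB V0.
  have -> : A * powR n (1 + al) <= (#|B|./2)%:R by move: leD; rewrite -/n -/M; lra.
  move/(_ isT); rewrite -/n => lo.
  have lo2 : 2 * (M * th) <= #|embeddings H B|%:R.
    have -> : 2 * (M * th) = eta * (p / 6) ^+ nedges H * n ^+ nverts H.
      rewrite Mth -[c1 * _ * _]mulrA mulrA c12 expr_div_n.
      by rewrite -!mulrA; congr (_ * _); rewrite mulrCA.
    apply: le_trans lo; rewrite ler_wpM2r ?exprn_ge0 ?(ltW n0) //.
    rewrite ler_wpM2l ?(ltW eta0) //.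
    rewrite lerXn2r // ?nnegrE ?divr_ge0 ?exprn_ge0 ?ler0n ?(ltW p0) //.
    rewrite pE mulrAC ler_pM2r ?invr_gt0 ?exprn_gt0 //; lra.
  have up : (#|embeddings H B| <= \sum_(e in B) Y e)%N.
    rewrite (card_embeddings_rooted B ab); apply: leq_sum => e _.
    rewrite /Y /both_rooted -[leqLHS]addn0 leq_add //.
    by apply: subset_leq_card; apply: rooted_mono => //; apply: subsetDl.
  have up2 : #|embeddings H B|%:R <= #|B|%:R * th.
    apply: (@le_trans _ _ (\sum_(e in B) (Y e)%:R)).
      by rewrite -natr_sum ler_nat.
    rewrite mulr_natl -sumr_const; apply: ler_sum => e.
    by rewrite !inE => /andP[+ eD']; rewrite eD' /= -ltNge => /ltW.
  have : #|B|%:R * th <= M * th by rewrite ler_pM2r // DEB lerDr.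
  have : 0 < M * th by rewrite mulr_gt0.
  lra.
have [|W lW] := @exists_rich_subset H V a b D (simple_edge_neq sH ab) E.
  move=> e; rewrite inE => /andP[_ leY]; rewrite -(ltr_nat R).
  exact: lt_le_trans leY.
exists W, [set e in E | rich a b D W e]; split.
- by apply: subset_trans sED; apply/subsetP => e; rewrite inE => /andP[].
- split=> [x y|x]; rewrite inE; last by rewrite (negPf (eE.2 x)).
  case/andP=> xyE; rewrite inE (eE.1 _ _ xyE) /= /rich both_rootedC.
  by rewrite (both_rootedC _ _ _ W) andbC [(_ \notin W) && _]andbC andbC.
- by move=> e; rewrite inE => /andP[_ /andP[]].
- move: lW; rewrite -(ler_nat R) natrM -/h => lW.
  apply: le_trans (ler_wpM2r (ltW M0) cl1) _.
  rewrite mulrAC mul1r ler_pdivrMr ?mulr_gt0 //; lra.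
- move=> e; rewrite !inE => /andP[/andP[_ leY] /andP[_]].
  rewrite -(ler_nat R) natrM -/h => lY.
  have ch : c * h <= c1 by rewrite -ler_pdivlMr.
  rewrite -(ler_pM2l h0); apply: le_trans lY; apply: le_trans leY.
  rewrite /th !mulrA [h * c]mulrC ler_wpM2r ?exprn_ge0 ?(ltW n0) //.
  by rewrite ler_wpM2r ?exprn_ge0 ?(ltW p0).
Qed.

Local Open Scope nat_scope.

(** * Maps that may collide on isolated vertices *)

Section QuasiEmbeddings.
Variables (H : graph) (V : finType) (D : {set V * V}).

Definition nonisolated (K : graph) : {set vtx K} :=
  [set x | [exists y, adj x y || adj y x]].

(** Letting [I] grow from the non-isolated vertices to [setT] interpolates between the maps produced
    by gluing and true embeddings. *)
Definition quasi_embeddings (I : {set vtx H}) : {set {ffun vtx H -> V}} :=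
  [set f : {ffun vtx H -> V} |
     [forall x in I, forall y in I, (f x == f y) ==> (x == y)] &&
     [forall x : vtx H, forall y : vtx H, adj x y ==> ((f x, f y) \in D)]].

Lemma quasi_embeddingsP (I : {set vtx H}) (f : {ffun vtx H -> V}) :
  reflect ({in I &, injective f} /\ forall x y, adj x y -> (f x, f y) \in D)
          (f \in quasi_embeddings I).
Proof.
rewrite inE; apply: (iffP andP) => -[].
  move=> /forall_inP inj_f /forallP hom_f; split=> [x y xI yI /eqP fxy|x y xy].
    by move/forall_inP: (inj_f x xI) => /(_ y yI)/implyP/(_ fxy)/eqP.
  by move/forallP: (hom_f x) => /(_ y) /implyP; apply.
move=> inj_f hom_f; split.
  apply/forall_inP => x xI; apply/forall_inP => y yI; apply/implyP => /eqP/inj_f-> //.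
by apply/forallP => x; apply/forallP => y; apply/implyP; apply: hom_f.
Qed.

Lemma quasi_embeddings_setT : quasi_embeddings setT = embeddings H D.
Proof.
apply/setP => f; apply/quasi_embeddingsP/embeddingsP => -[inj_f hom_f]; split=> //.
  by move=> x y; apply: inj_f; rewrite inE.
by move=> x y _ _; apply: inj_f.
Qed.

Let upd (x : vtx H) (f : {ffun vtx H -> V}) y : {ffun vtx H -> V} :=
  [ffun z => if z == x then y else f z].

(** The isolated vertex [x] may be moved to any [y] outside [f @: I], which leaves at least
    [#|V| - #|vtx H|] choices. The pair [(f, y)] is recovered from the old value [f x] and the
    updated map. *)
Lemma quasi_embeddings_setU1 (I : {set vtx H}) x :
  nonisolated H \subset I -> x \notin I ->
  #|quasi_embeddings I| * (#|V| - #|vtx H|) <= #|V| * #|quasi_embeddings (x |: I)|.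
Proof.
move=> sI xI; pose P := [set q : {ffun vtx H -> V} * V |
  (q.1 \in quasi_embeddings I) && (upd x q.1 q.2 \in quasi_embeddings (x |: I))].
have iso y : ~~ adj x y && ~~ adj y x.
  rewrite -negb_or; apply: contra xI => xy; apply: (subsetP sI); rewrite inE.
  by apply/existsP; exists y.
apply: (@leq_trans #|P|).
  rewrite -sum_nat_const -[#|P|]sum1_card.
  rewrite (partition_big (fun q => q.1) (mem (quasi_embeddings I))) /=; last first.
    by move=> q; rewrite inE => /andP[].
  apply: leq_sum => f fI; have /quasi_embeddingsP[inj_f hom_f] := fI.
  apply: (@leq_trans #|~: (f @: I)|).
    rewrite -(cardsC (f @: I)) leq_subLR leq_add //.
    exact: leq_trans (leq_imset_card _ _) (max_card _).
  rewrite sum1dep_card -(card_imset (mem (~: (f @: I))) (_ : injective (pair f))).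
    apply/subset_leq_card/subsetP => q /imsetP[y yI ->].
    rewrite [X in is_true X]in_set; apply/andP; split; last exact: eqxx.
    rewrite [X in is_true X]in_set fI /=.
    apply/quasi_embeddingsP; split=> [z w|z w zw].
      have yn w' : w' \in I -> f w' <> y.
        by move=> wI yE; move: yI; rewrite inE -yE imset_f.
      rewrite !inE !ffunE; case: (eqVneq z x) => [->|_] /=; case: (eqVneq w x) => [->|_] //=.
      - by move=> _ /yn nw /esym.
      - by move=> /yn.
      - exact: inj_f.
    have [zx wx] : z != x /\ w != x.
      by split; apply: contraTneq zw => ->; [case/andP: (iso w)|case/andP: (iso z)].
    by rewrite !ffunE (negPf zx) (negPf wx); apply: hom_f.
  by move=> y y' [].
rewrite -cardsT -cardsX.
rewrite -(@card_in_imset _ _ (fun q : {ffun vtx H -> V} * V => (q.1 x, upd x q.1 q.2)) P).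
  apply/subset_leq_card/subsetP => r /imsetP[q]; rewrite [X in is_true X -> _]in_set => /andP[_ qU] ->.
  by rewrite in_setX /= qU inE.
move=> [f y] [f' y'] _ _ /= [fx /ffunP E]; congr (_, _).
  apply/ffunP => z; have := E z; rewrite !ffunE; case: eqVneq => [->|] //.
by have := E x; rewrite !ffunE eqxx.
Qed.

(** Add the missing vertices one at a time; since [#|V|] is at least twice [#|vtx H|], each costs a
    factor of at most 2. *)
Lemma quasi_embeddings_leq (I : {set vtx H}) :
  nonisolated H \subset I -> 2 * #|vtx H| <= #|V| ->
  #|quasi_embeddings I| <= 2 ^ #|vtx H| * #|embeddings H D|.
Proof.
move=> sI lV; apply: (@leq_trans (2 ^ #|~: I| * #|embeddings H D|)); last first.
  by rewrite leq_mul2r leq_exp2l // max_card orbT.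
move En : #|~: I| => n; elim: n I sI En => [|n IH] I sI En.
  by rewrite mul1n -quasi_embeddings_setT; move/cards0_eq: En => /(congr1 (@setC _));
     rewrite setCK setC0 => ->.
have /card_gt0P[x] : 0 < #|~: I| by rewrite En.
rewrite inE => xI; have := quasi_embeddings_setU1 sI xI.
have := IH (x |: I) (subset_trans sI (subsetUr _ _)).
have := cardsU1 x I; have := cardsC I; have := cardsC (x |: I).
rewrite xI En => c1 c2 c3; have En' : #|~: (x |: I)| = n by lia.
move=> /(_ En').
have : 0 < #|vtx H| by apply/card_gt0P; exists x.
rewrite expnS; nia.
Qed.

End QuasiEmbeddings.

(** * Vertices and edges of a glued graph *)

Section GlueFacts.
Variables (t : nat) (H : 'I_t -> graph) (a b : forall i, vtx (H i)).
Hypothesis nab : forall i, a i != b i.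
Implicit Type sigma : 'I_t -> bool.

Let interior i (x : vtx (H i)) := (x != a i) && (x != b i).

Lemma glue_map_interior sigma i (x : vtx (H i)) (h : interior x) :
  glue_map a b sigma x =
  inr (Tagged (fun j => {w : vtx (H j) | (w != a j) && (w != b j)})
              (exist (fun w => (w != a i) && (w != b i)) x h)).
Proof.
(* The proof [h'] produced by [idP] may differ from [h]; injectivity of [val] identifies the two
   subtype elements. *)
rewrite /glue_map; case: {-}_ / (@idP ((x != a i) && (x != b i))) => // h'.
by congr (inr (Tagged _ _)); apply: val_inj.
Qed.

Lemma glue_map_a sigma i :
  glue_map a b sigma (a i) = inl (if sigma i then ord_max else ord0).
Proof.
rewrite /glue_map; case: {-}_ / (@idP ((a i != a i) && (a i != b i))) => [h|_].
  by exfalso; move: h; rewrite eqxx.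
by rewrite eqxx.
Qed.

Lemma glue_map_b sigma i :
  glue_map a b sigma (b i) = inl (if sigma i then ord0 else ord_max).
Proof.
rewrite /glue_map; case: {-}_ / (@idP ((b i != a i) && (b i != b i))) => [h|_].
  by exfalso; move: h; rewrite eqxx andbF.
by rewrite eq_sym (negPf (nab i)).
Qed.

Variant root_spec i (x : vtx (H i)) : Type :=
  | RootA of x = a i
  | RootB of x = b i
  | Interior of interior x.

Lemma root_vertexP i (x : vtx (H i)) : root_spec x.
Proof.
have [xa|xa] := eqVneq x (a i); first exact: RootA.
have [xb|xb] := eqVneq x (b i); first exact: RootB.
by apply: Interior; rewrite /interior xa xb.
Qed.

Lemma glue_map_inj sigma i : injective (@glue_map t H a b sigma i).
Proof.
move=> x y; case: (root_vertexP x) => [->|->|hx]; case: (root_vertexP y) => [->|->|hy] //;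
  rewrite ?glue_map_a ?glue_map_b ?glue_map_interior //; try by case: ifP.
by case=> /eqP; rewrite eq_Tagged /= => /eqP.
Qed.

Lemma nverts_glue sigma :
  nverts (glue a b sigma) = 2 + \sum_(i < t) (nverts (H i) - 2).
Proof.
rewrite /nverts /= card_sum card_ord card_tagged; congr (_ + _).
rewrite sumnE big_map big_enum /=; apply: eq_bigr => i _; rewrite card_sig.
have := cardC (mem [set a i; b i]); rewrite cards2 nab => <-; rewrite addKn.
by apply: eq_card => x; rewrite !inE negb_or.
Qed.

(** The ordered pairs on the common edge are disjoint from the images of pairs with an interior
    endpoint, and the latter do not collide, since an interior vertex remembers its index. As
    densities are at most 1, a lower bound on the exponent is what the goodness estimate calls
    for. *)
Lemma nedges_glue sigma : 0 < t ->
  (forall i, simple_graph (H i)) -> (forall i, adj (a i) (b i)) ->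
  (\sum_(i < t) (nedges (H i)).-1).+1 <= nedges (glue a b sigma).
Proof.
move=> t0 sH ab.
pose T := {i : 'I_t & (vtx (H i) * vtx (H i))%type}.
pose S : {set T} := [set s | adj (tagged s).1 (tagged s).2 &&
  (interior (tagged s).1 || interior (tagged s).2)].
pose gm (s : T) : glue_vtx a b * glue_vtx a b :=
  (glue_map a b sigma (tagged s).1, glue_map a b sigma (tagged s).2).
pose ends : {set glue_vtx a b * glue_vtx a b} :=
  [set (inl ord0, inl ord_max); (inl ord_max, inl ord0)].
have dis : [disjoint ends & gm @: S].
  rewrite disjoint_sym disjoints_subset; apply/subsetP => _ /imsetP[[i [x y]] sS ->].
  move: sS; rewrite !inE /gm /= !xpair_eqE => /andP[_ /orP[]] h;
    by rewrite (glue_map_interior _ h) ?andbF.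
have inj : {in S &, injective gm}.
  move=> [i [x y]] [j [z w]]; rewrite !inE /= => /andP[_ xy] /andP[_ zw].
  case=> e1 e2.
  have ij : i = j.
    case/orP: xy => h; [move: e1|move: e2]; rewrite (glue_map_interior _ h).
      case: (root_vertexP z) => [->|->|h']; rewrite ?glue_map_a ?glue_map_b //.
      by rewrite (glue_map_interior _ h') => -[].
    case: (root_vertexP w) => [->|->|h']; rewrite ?glue_map_a ?glue_map_b //.
    by rewrite (glue_map_interior _ h') => -[].
  by subst j; rewrite (glue_map_inj e1) (glue_map_inj e2).
have sub : ends :|: gm @: S \subset
    [set p : vtx (glue a b sigma) * vtx (glue a b sigma) | adj p.1 p.2].
  apply/subsetP => p; rewrite !inE => /orP[|/imsetP[[i [x y]] + ->]]; last first.
    rewrite inE /= => /andP[xy _]; apply/existsP; exists i; apply/existsP; exists x.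
    by apply/existsP; exists y; rewrite xy !eqxx.
  pose i0 := Ordinal t0.
  have ab0 := ab i0; have ba0 : adj (b i0) (a i0) by rewrite -(sH i0).2.
  case si: (sigma i0) => /orP[]/eqP->; apply/existsP; exists i0; apply/existsP;
    [exists (b i0)|exists (a i0)|exists (a i0)|exists (b i0)]; apply/existsP;
    [exists (a i0)|exists (b i0)|exists (b i0)|exists (a i0)];
    by rewrite ?ab0 ?ba0 /= glue_map_a glue_map_b si !eqxx.
have cS : #|S| = \sum_(i < t) #|[set p : vtx (H i) * vtx (H i) |
    adj p.1 p.2 && (interior p.1 || interior p.2)]|.
  rewrite -sum1_card big_mkcond /=.
  under [RHS]eq_bigr do rewrite -sum1dep_card big_mkcond.
  rewrite sig_big_dep /=.
  by apply: eq_bigr => -[i p] _; rewrite inE.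
(* Only the two orientations of the root edge have no interior endpoint. *)
have lS : \sum_(i < t) 2 * (nedges (H i)).-1 <= #|S|.
  rewrite cS; apply: leq_sum => i _; rewrite /nedges.
  set E := [set p | adj p.1 p.2]; set E' := [set p | _ && _].
  have : E \subset E' :|: [set (a i, b i); (b i, a i)].
    apply/subsetP => -[x y]; rewrite !inE /= => xy; rewrite xy /= !xpair_eqE.
    case: (root_vertexP x) xy => [->|->|->]//; case: (root_vertexP y) => [->|->|->]; rewrite ?orbT ?eqxx ?orbT //.
      by rewrite (negPf ((sH i).1 _)).
    by rewrite (negPf ((sH i).1 _)).
  move/subset_leq_card => /leq_trans/(_ (leq_card_setU _ _)).
  have : #|[set (a i, b i); (b i, a i)]| <= 2 by rewrite cards2; case: (_ != _).
  by set N := #|E|; set N' := #|E'|; set N2 := #|_|; lia.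
have cU := cardsUI ends (gm @: S).
rewrite (disjoint_setI0 dis) cards0 addn0 card_in_imset // cards2 in cU.
rewrite -big_distrr /= in lS; have := subset_leq_card sub; rewrite cU /nedges.
move: #|[set p : vtx (glue a b sigma) * vtx (glue a b sigma) | adj p.1 p.2]| => N.
rewrite xpair_eqE /=.
move: lS; move: (\sum_(i < t) _) #|S| => Z s; clear; lia.
Qed.

End GlueFacts.

(** * Copies of glued graphs from a nested chain of edge sets *)

Section GlueEmbeddings.
Variables (t : nat) (H : 'I_t -> graph) (a b : forall i, vtx (H i)).
Hypothesis nab : forall i, a i != b i.
Variables (V : finType) (Ds : nat -> {set V * V}) (Ws : nat -> {set V}).
Hypothesis sym0 : edge_set (Ds 0).
Hypothesis Ds_sub : forall i, i < t -> Ds i.+1 \subset Ds i.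
Hypothesis Ds_avoid : forall i, i < t ->
  forall e, e \in Ds i.+1 -> (e.1 \notin Ws i) && (e.2 \notin Ws i).

Lemma Ds_mono i j : i <= j <= t -> Ds j \subset Ds i.
Proof.
elim: j => [|j IH] /andP[]; first by rewrite leqn0 => /eqP->.
rewrite leq_eqVlt => /orP[/eqP->//|lij] ljt.
by apply: subset_trans (Ds_sub ljt) (IH _); rewrite -ltnS lij ltnW.
Qed.

Lemma Ds_notin_W i j e : i < j <= t -> e \in Ds j ->
  (e.1 \notin Ws i) && (e.2 \notin Ws i).
Proof.
move=> /andP[lij ljt] eD; apply: Ds_avoid; first exact: leq_trans lij ljt.
by apply: (subsetP (Ds_mono _)) eD; rewrite lij ljt.
Qed.

Let rooted_at sigma u v i := rooted (a i) (b i) (Ds i) (Ws i)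
  (if sigma i then v else u) (if sigma i then u else v).

(* Earlier graphs lose their interior set [Ws i] before later copies are chosen, so the
   non-isolated interior vertices of distinct copies cannot collide; isolated vertices can. *)
Lemma prod_rooted_glue (sigma : 'I_t -> bool) u v : (u, v) \in Ds t ->
  \prod_(i < t) #|rooted_at sigma u v i| <=
  #|[set g in quasi_embeddings (Ds 0) (nonisolated (glue a b sigma)) |
       (g (inl ord0), g (inl ord_max)) == (u, v)]|.
Proof.
move=> uvD; have uvD0 : (u, v) \in Ds 0 by apply: (subsetP (@Ds_mono 0 t _)) uvD; rewrite leqnn.
have nuv : u != v by apply: contraTneq uvD0 => ->; exact: (sym0.2 v).
pose F i : pred {ffun vtx (H i) -> V} := fun f => f \in rooted_at sigma u v i.
pose fT := {dffun forall i : 'I_t, {ffun vtx (H i) -> V}}.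
pose Fam := family F : simpl_pred fT.
pose mk (phi : fT) :
    {ffun vtx (glue a b sigma) -> V} :=
  [ffun p => match p with
             | inl k => if k == ord0 then u else v
             | inr q => phi (tag q) (sval (tagged q))
             end].
(* On the roots this works for both values of [sigma i]: [rooted_at] swaps [u] and [v] exactly when
   [glue_map] swaps [ord0] and [ord_max]. *)
have mkE (phi : fT) i (x : vtx (H i)) : phi \in Fam ->
    mk phi (glue_map a b sigma x) = phi i x.
  move=> /familyP/(_ i)/rootedP[_ phia phib _]; rewrite ffunE.
  case: (root_vertexP a b x) => [->|->|h].
  - by rewrite glue_map_a phia; case: (sigma i).
  - by rewrite (glue_map_b nab) phib; case: (sigma i).
  - by rewrite (glue_map_interior _ h).
have -> : \prod_(i < t) #|rooted_at sigma u v i| = #|Fam|.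
  rewrite (card_family F) foldrE big_image /=; apply: eq_bigr => i _.
  by apply: eq_card => f; rewrite unfold_in.
rewrite -(@card_in_imset _ _ mk Fam); last first.
  move=> phi psi Fphi Fpsi E; apply/ffunP => i; apply/ffunP => x.
  by rewrite -!mkE // E.
apply/subset_leq_card/subsetP => g /imsetP[phi Fphi ->].
rewrite [X in is_true X]in_set; apply/andP; split; last by rewrite !ffunE.
have phiP i := rootedP _ _ _ _ _ _ _ (familyP Fphi i).
have hom x y : adj x y -> (mk phi x, mk phi y) \in Ds 0.
  move=> /existsP[i /existsP[x' /existsP[y' /and3P[xy /eqP<- /eqP<-]]]].
  rewrite !mkE //; apply: (subsetP (@Ds_mono 0 i _)); first exact: ltnW (ltn_ord i).
  by have [/embeddingsP[_ hm] _ _ _] := phiP i; apply: hm.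
apply/quasi_embeddingsP; split=> // p q pI qI.
(* The common edge lies in the last set [Ds t], hence avoids every [Ws i]. *)
have uvW i : i < t -> (u \notin Ws i) && (v \notin Ws i).
  by move=> lit; apply: (Ds_notin_W (j := t) (e := (u, v))) => //; rewrite lit /=.
have inlW (k : 'I_2) i : i < t -> mk phi (inl k) \notin Ws i.
  by move=> /uvW/andP[uW vW]; rewrite ffunE; case: ifP.
have inrW s : mk phi (inr s) \in Ws (tag s).
  rewrite ffunE; case: s => i [x /= /andP[xa xb]].
  by have [_ _ _] := phiP i; apply.
(* A non-isolated interior vertex is mapped to an end of an edge of [Ds (tag s)], and this set
   avoids all earlier [Ws j]. *)
have inrnW s j : inr s \in nonisolated (glue a b sigma) -> j < tag s ->
    mk phi (inr s) \notin Ws j.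
  move=> + lj.
  have avoid i (z w : vtx (H i)) : adj z w -> i = tag s ->
      (phi i z \notin Ws j) && (phi i w \notin Ws j).
    move=> zw ei; apply: (Ds_notin_W (j := i) (e := (phi i z, phi i w))).
      by rewrite ei lj ltnW.
    by have [/embeddingsP[_ hm] _ _ _] := phiP i; apply: hm.
  have tagE i (z : vtx (H i)) : glue_map a b sigma z = inr s -> i = tag s.
    case: (root_vertexP a b z) => [->|->|h]; rewrite ?glue_map_a ?(glue_map_b nab) //.
    by rewrite (glue_map_interior _ h) => -[<-].
  rewrite inE => /existsP[y /orP[]] /existsP[i /existsP[z /existsP[w]]].
    case/and3P=> zw /eqP zs _; rewrite -zs mkE //.
    by case/andP: (avoid _ _ _ zw (tagE _ _ zs)).
  case/and3P=> zw _ /eqP ws; rewrite -ws mkE //.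
  by case/andP: (avoid _ _ _ zw (tagE _ _ ws)).
case: p pI => [k|s] pI; case: q qI => [l|r] qI E.
- congr inl; move: E; rewrite !ffunE; case: k l {pI qI} => [[|[|//]] lk] [[|[|//]] ll] /=;
    do ?[move=> _; exact: val_inj].
  + by move/eqP; rewrite (negPf nuv).
  + by move/esym/eqP; rewrite (negPf nuv).
- by have := inlW k _ (ltn_ord (tag r)); rewrite E inrW.
- by have := inlW l _ (ltn_ord (tag s)); rewrite -E inrW.
(* With distinct indices, the vertex of larger index would avoid the interior set containing the
   other; within one index the copy is injective. *)
- have ets : tag s = tag r.
    case: (ltngtP (tag s) (tag r)) => [lt|lt|/val_inj//].
      by have := inrnW _ _ qI lt; rewrite -E inrW.
    by have := inrnW _ _ pI lt; rewrite E inrW.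
  move: E; rewrite !ffunE; case: s r ets {pI qI} => i [x hx] [j [y hy]] /= ij.
  subst j => /= E; have [/embeddingsP[inj _] _ _ _] := phiP i.
  by have exy := inj _ _ E; subst y; congr (inr (Tagged _ _)); apply: val_inj.
Qed.

(** Distributing the product of two-term sums yields one term for each choice of orientations, that
    is, for each [sigma]. *)
Lemma prod_both_rooted_glue (e : V * V) : e \in Ds t ->
  \prod_(i < t) both_rooted (a i) (b i) (Ds i) (Ws i) e <=
  \sum_(sigma : {ffun 'I_t -> bool})
    #|[set g in quasi_embeddings (Ds 0) (nonisolated (glue a b sigma)) |
         (g (inl ord0), g (inl ord_max)) == e]|.
Proof.
case: e => u v uvD.
have -> : \prod_(i < t) both_rooted (a i) (b i) (Ds i) (Ws i) (u, v) =
    \sum_(sigma : {ffun 'I_t -> bool}) \prod_(i < t) #|rooted_at sigma u v i|.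
  rewrite -(bigA_distr_bigA (fun i s => #|rooted (a i) (b i) (Ds i) (Ws i)
    (if s then v else u) (if s then u else v)|)).
  by apply: eq_bigr => i _; rewrite big_bool /both_rooted /= addnC.
by apply: leq_sum => sigma _; apply: prod_rooted_glue.
Qed.

(** A map determines the image of the common edge, so the families counted for distinct [e] are
    disjoint. *)
Lemma sum_quasi_glue :
  \sum_(e in Ds t) \prod_(i < t) both_rooted (a i) (b i) (Ds i) (Ws i) e <=
  \sum_(sigma : {ffun 'I_t -> bool})
    #|quasi_embeddings (Ds 0) (nonisolated (glue a b sigma))|.
Proof.
apply: leq_trans; first by apply: leq_sum => e; exact: prod_both_rooted_glue.
rewrite exchange_big /=; apply: leq_sum => sigma _.
set Q := quasi_embeddings _ _.
pose ends (g : {ffun vtx (glue a b sigma) -> V}) := (g (inl ord0), g (inl ord_max)).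
rewrite -[leqRHS]sum1_card (partition_big ends predT) //=.
rewrite [leqRHS](bigID (mem (Ds t))) /=; apply: leq_trans (leq_addr _ _).
by apply: leq_sum => e _; rewrite -sum1dep_card.
Qed.

End GlueEmbeddings.

(** * Iterating the thinning step *)

(** Dependent choice of length [t]: [Q] is the invariant that lets the next step start, [P] records
    what each step achieves. The sequences are total on [nat], with arbitrary values past the
    end. *)
Lemma finite_chain (X Y : Type) (y0 : Y) (t : nat)
    (P : 'I_t -> X -> Y -> X -> Prop) (Q : nat -> X -> Prop) (x0 : X) :
  Q 0 x0 ->
  (forall (i : 'I_t) x, Q i x -> exists y x', P i x y x' /\ Q i.+1 x') ->
  exists (xs : nat -> X) (ys : nat -> Y), [/\ xs 0 = x0,
    forall i : 'I_t, P i (xs i) (ys i) (xs i.+1) &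
    forall k, k <= t -> Q k (xs k)].
Proof.
move=> Q0 step.
suff : forall k, k <= t -> exists (xs : nat -> X) (ys : nat -> Y), [/\ xs 0 = x0,
    forall i : 'I_t, i < k -> P i (xs i) (ys i) (xs i.+1) &
    forall j, j <= k -> Q j (xs j)].
  case/(_ t (leqnn t)) => xs [ys [e0 Pi Qk]]; exists xs, ys; split=> // i.
  exact: Pi.
elim=> [|k IH] lkt.
  by exists (fun=> x0), (fun=> y0); split=> // j; rewrite leqn0 => /eqP->.
have [xs [ys [e0 Pi Qk]]] := IH (ltnW lkt).
have [y [x' [Pk Qk1]]] := step (Ordinal lkt) _ (Qk k (leqnn k)).
exists (fun j => if j <= k then xs j else x'), (fun j => if j < k then ys j else y).
split=> // [i lik|j ljk].
  have /orP[/eqP ik|lik'] : (nat_of_ord i == k) || (i < k) by rewrite -leq_eqVlt.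
    rewrite /= ik leqnn ltnn; have -> : i = Ordinal lkt by apply: val_inj.
    exact: Pk.
  by rewrite /= lik' (ltnW lik'); apply: Pi.
case: leqP => [|lkj]; first exact: Qk.
by have -> : j = k.+1 by apply/eqP; rewrite eqn_leq ljk lkj.
Qed.

Lemma copies_embeddings (K G : graph) :
  copies K G = #|embeddings K [set p : vtx G * vtx G | adj p.1 p.2]|.
Proof.
apply: eq_card => f; rewrite !inE; congr (_ && _).
by apply: eq_forallb => x; apply: eq_forallb => y; rewrite inE.
Qed.

Lemma edge_set_graph (G : graph) :
  simple_graph G -> edge_set [set p : vtx G * vtx G | adj p.1 p.2].
Proof. by case=> irr sym; split=> [x y|x]; rewrite !inE //= sym. Qed.

Lemma copies_isomorphic (K K' G : graph) : isomorphic K K' -> copies K' G <= copies K G.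
Proof.
case=> f [[g fK gK] fadj]; rewrite !copies_embeddings.
pose F (h : {ffun vtx K' -> vtx G}) : {ffun vtx K -> vtx G} := [ffun x => h (f x)].
have injF : injective F.
  move=> h h' /ffunP E; apply/ffunP => y.
  by have := E (g y); rewrite !ffunE gK.
rewrite -(card_imset _ injF); apply/subset_leq_card/subsetP => _ /imsetP[h + ->].
case/embeddingsP => inj_h hom_h; apply/embeddingsP; split=> [x y|x y xy].
  by rewrite !ffunE => /inj_h/(can_inj fK).
by rewrite !ffunE; apply: hom_h; rewrite fadj.
Qed.

Local Open Scope ring_scope.

(** Monotonicity in the exponent is for bases at least 1; at base 0 both powers vanish because the
    exponents are positive. *)
Lemma ler_powRn (R : realType) (n : nat) (x y : R) :
  0 < x -> x <= y -> powR n%:R x <= powR n%:R y.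
Proof.
move=> x0 xy; case: n => [|n]; last by apply: ler_powR => //; rewrite ler1n.
by rewrite !powR0 // gt_eqF // (lt_le_trans x0 xy).
Qed.

Lemma nedges_leq (G : graph) : (nedges G <= nverts G ^ 2)%N.
Proof.
apply: leq_trans (half_leq (max_card _)) _; rewrite card_prod /nverts mulnn.
by move: (_ ^ 2)%N => N; lia.
Qed.

(** * Supersaturation for the family of glued graphs *)

(** The bound is on the sum over all [sigma], because [both_rooted] does not tell which orientation
    supplies the copies. *)
Lemma glue_supersaturated (R : realType) (t : nat) (H : 'I_t -> graph)
    (alpha A eta : 'I_t -> R) (a b : forall i, vtx (H i)) :
  (forall i, simple_graph (H i)) -> (forall i, 0 <= alpha i) ->
  (forall i, 0 < A i) -> (forall i, 0 < eta i) ->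
  (forall i, ES_good (alpha i) (A i) (eta i) (H i)) ->
  (forall i, adj (a i) (b i)) ->
  exists A0 c : R, [/\ 0 < A0, 0 < c & forall G : graph, simple_graph G ->
    A0 * powR (nverts G)%:R (1 + \big[Num.max/0]_(i < t) alpha i) <= (nedges G)%:R ->
    c * ((nedges G)%:R / (nverts G)%:R ^+ 2) ^+ (\sum_(i < t) (nedges (H i)).-1).+1
      * (nverts G)%:R ^+ (2 + \sum_(i < t) (nverts (H i) - 2))
    <= \sum_(sigma : {ffun 'I_t -> bool}) (copies (glue a b sigma) G)%:R].
Proof.
move=> sH al0 A0 eta0 good ab.
have nab i := simple_edge_neq (sH i) (ab i).
set am := \big[Num.max/0]_(i < t) alpha i.
have am0 : 0 <= am by rewrite bigmax_ge_id.
have leam i : alpha i <= am by apply: le_bigmax.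
have /fin_all_exists2[cc cc0 ccP] i := rooted_robust (sH i) (ab i) (eta0 i) (good i).
pose c := \big[Num.min/1]_(i < t) cc i.
have c0 : 0 < c by apply: lt_bigmin.
have c1 : c <= 1 by apply: bigmin_le_id.
have ccle i : c <= cc i by apply: bigmin_le.
pose K : R := \sum_(i < t) 6 * A i.
have K0 : 0 <= K by apply: sumr_ge0 => i _; rewrite mulr_ge0 // ltW.
have leK i : 6 * A i <= K.
  rewrite /K (bigD1 i) //= lerDl; apply: sumr_ge0 => j _.
  by rewrite mulr_ge0 // ltW.
pose nv := (2 + \sum_(i < t) (nverts (H i) - 2))%N.
pose S := (\sum_(i < t) (nedges (H i)).-1)%N.
have ct0 : 0 < c ^+ t by rewrite exprn_gt0.
(* The factors pay, in order, for the size of the last edge set, the [t] constants of the rooted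
   counts, the density lost in each [D_i], and the re-embedding of isolated vertices. *)
pose C := c ^+ t * c ^+ t * (c ^+ t) ^+ S / (2 ^ nv)%:R.
have N0 : 0 < (2 ^ nv)%:R :> R by rewrite ltr0n expn_gt0.
(* The first summand keeps every [D_i] dense enough for the next step; the second, as [m <= n ^ 2],
   forces [n] to be at least [2 * nv] for [quasi_embeddings_leq]. *)
exists (K / c ^+ t + (2 * nv).+1%:R), C; split.
- by apply: ltr_wpDl; rewrite ?divr_ge0 ?(ltW ct0).
- by apply: divr_gt0 => //; rewrite !mulr_gt0 ?exprn_gt0.
move=> G sG; set n := (nverts G)%:R; set m : R := (nedges G)%:R => mbig.
have [V0|V0] := posnP (nverts G).
  by rewrite /n V0 exprD expr2 !mul0r mulr0; apply: sumr_ge0.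
have n0 : 0 < n by rewrite ltr0n.
set D0 := [set p : vtx G * vtx G | adj p.1 p.2].
have m_le : m <= #|D0|%:R by rewrite ler_nat /nedges -/D0; lia.
have pw0 : 0 <= powR n (1 + am) by apply: powR_ge0.
have Ksmall : K * powR n (1 + am) <= c ^+ t * #|D0|%:R.
  have -> : K * powR n (1 + am) = c ^+ t * (K / c ^+ t * powR n (1 + am)).
    by rewrite mulrA [c ^+ t * _]mulrC divfK // gt_eqF.
  apply: ler_wpM2l; first exact: ltW.
  by apply: le_trans m_le; apply: le_trans mbig; rewrite ler_wpM2r // lerDl.
have nbig : (2 * nv <= nverts G)%N.
  have h1 : (2 * nv).+1%:R * n <= m.
    apply: le_trans mbig; apply: ler_pM => //; rewrite ?(ltW n0) //.
      by rewrite lerDr divr_ge0 // ltW.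
    rewrite -[leLHS]powRr1 ?(ltW n0) //; apply: ler_powRn => //.
    by rewrite lerDl.
  have h2 : m <= n * n by rewrite -natrM ler_nat mulnn nedges_leq.
  have := le_trans h1 h2; rewrite ler_pM2r // ler_nat; exact: ltnW.
pose Q k (D : {set vtx G * vtx G}) : Prop :=
  edge_set D /\ c ^+ k * #|D0|%:R <= #|D|%:R.
pose P (i : 'I_t) (D : {set vtx G * vtx G}) (W : {set vtx G}) (D' : {set vtx G * vtx G}) : Prop :=
  [/\ D' \subset D,
      forall e, e \in D' -> (e.1 \notin W) && (e.2 \notin W) &
      forall e, e \in D' -> c * (#|D|%:R / n ^+ 2) ^+ (nedges (H i)).-1
         * n ^+ (nverts (H i) - 2) <= (both_rooted (a i) (b i) D W e)%:R].
have ck k : (k <= t)%N -> c ^+ t <= c ^+ k.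
  by move=> lk; apply: ler_wiXn2l => //; apply: ltW.
have [||Ds [Ws [Ds0 DsP DsQ]]] := @finite_chain _ _ set0 t P Q D0.
- by split; [exact: edge_set_graph|rewrite expr0 mul1r].
- move=> i D [eD cD].
  have [||W [D' [sub eD' av big rich]]] := ccP i (vtx G) D.
  + exact: eD.
  + apply: le_trans cD; apply: (@le_trans _ _ (K * powR n (1 + am))).
      apply: ler_pM; [by rewrite mulr_ge0 // ltW|exact: powR_ge0|exact: leK|].
      by apply: (@ler_powRn R (nverts G)); [apply: ltr_pwDl|rewrite lerD2l].
    apply: le_trans Ksmall _; rewrite ler_wpM2r // ck // ltnW //.
  exists W, D'; split; split=> //.
    move=> e /rich; apply: le_trans; rewrite ler_wpM2r ?exprn_ge0 ?(ltW n0) //.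
    by rewrite ler_wpM2r ?exprn_ge0 ?divr_ge0 ?exprn_ge0 ?(ltW n0).
  apply: le_trans big; rewrite exprS -mulrA.
  by apply: ler_pM => //; rewrite ?mulr_ge0 ?exprn_ge0 ?(ltW c0).
set p := m / n ^+ 2.
have p0 : 0 <= p by rewrite divr_ge0 ?exprn_ge0 ?(ltW n0).
(* Each [D_i] keeps a [c ^ t] share of [D0] and [m <= #|D0|], so its density is at least
   [c ^ t * p]. *)
pose th i := c * (c ^+ t * p) ^+ (nedges (H i)).-1 * n ^+ (nverts (H i) - 2).
have th0 i : 0 <= th i.
  apply: mulr_ge0; last by rewrite exprn_ge0 // ltW.
  by apply: mulr_ge0; [exact: ltW|rewrite exprn_ge0 // mulr_ge0 // ltW].
have both_ge i e : e \in Ds t ->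
    th i <= (both_rooted (a i) (b i) (Ds i) (Ws i) e)%:R.
  move=> eD; have [_ _ rich] := DsP i.
  have eDi : e \in Ds i.+1.
    have sub j : (j < t)%N -> Ds j.+1 \subset Ds j.
      by move=> lj; have [] := DsP (Ordinal lj).
    apply: (subsetP (Ds_mono sub _)) eD; exact/andP.
  apply: le_trans (rich e eDi); rewrite ler_wpM2r ?exprn_ge0 ?(ltW n0) //.
  rewrite ler_wpM2l ?(ltW c0) //; apply: lerXn2r; rewrite ?nnegrE.
  - by rewrite mulr_ge0 // ltW.
  - by rewrite divr_ge0 ?exprn_ge0 ?(ltW n0).
  rewrite /p mulrA ler_wpM2r ?invr_ge0 ?exprn_ge0 ?(ltW n0) //.
  have [_ cD] := DsQ i (ltnW (ltn_ord i)); apply: le_trans cD.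
  by apply: ler_pM; rewrite ?(ltW ct0) // ck // ltnW.
have lo : c ^+ t * m * \prod_(i < t) th i <=
    (\sum_(e in Ds t) \prod_(i < t) both_rooted (a i) (b i) (Ds i) (Ws i) e)%:R.
  apply: (@le_trans _ _ (\sum_(e in Ds t) \prod_(i < t) th i)).
    rewrite sumr_const -[leRHS]mulr_natl; apply: ler_wpM2r; first exact: prodr_ge0.
    have [_ cD] := DsQ t (leqnn t); apply: le_trans cD.
    by rewrite ler_wpM2l // ltW.
  rewrite natr_sum; apply: ler_sum => e eD; rewrite natr_prod.
  by apply: ler_prod => i _; rewrite th0 both_ge.
(* Since [m = p * n ^ 2], the common edge supplies the last factor [p] and the 2 in [nv]. *)
have thE : c ^+ t * m * \prod_(i < t) th i =
    c ^+ t * c ^+ t * (c ^+ t) ^+ S * p ^+ S.+1 * n ^+ nv.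
  rewrite /th !big_split /= prodr_const card_ord !prodrXr -/S exprMn.
  rewrite exprD exprS [in RHS]/p; field.
  by rewrite gt_eqF.
have up : (\sum_(e in Ds t) \prod_(i < t) both_rooted (a i) (b i) (Ds i) (Ws i) e <=
    \sum_(sigma : {ffun 'I_t -> bool}) 2 ^ nv * copies (glue a b sigma) G)%N.
  apply: leq_trans (sum_quasi_glue nab _ _ _) _.
  - by rewrite Ds0; apply: edge_set_graph.
  - by move=> i lt; have [] := DsP (Ordinal lt).
  - by move=> i lt; have [] := DsP (Ordinal lt).
  apply: leq_sum => sigma _; rewrite copies_embeddings Ds0.
  have nvE : #|vtx (glue a b sigma)| = nv := nverts_glue nab sigma.
  by rewrite -nvE; apply: quasi_embeddings_leq; rewrite ?nvE.
have CE : C * p ^+ S.+1 * n ^+ nv = c ^+ t * m * \prod_(i < t) th i / (2 ^ nv)%:R.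
  by rewrite thE /C ![_ / _ * _]mulrAC.
rewrite -/S -/nv CE ler_pdivrMr // mulr_suml; apply: le_trans lo _.
move: up; rewrite -(ler_nat R) => /le_trans; apply.
by rewrite natr_sum; apply: ler_sum => sigma _; rewrite natrM mulrC.
Qed.

(** * The extremal bound and goodness of a unique glued graph *)

Unset Implicit Arguments.

Theorem theorem3p4 (R : realType) (t : nat) (H : 'I_t -> graph)
  (alpha A eta : 'I_t -> R) (a b : forall i, vtx (H i)) :
  (0 < t)%N ->
  (forall i, simple_graph (H i)) ->
  (forall i, 0 <= alpha i < 1) ->
  (forall i, 0 < A i) -> (forall i, 0 < eta i) ->
  (forall i, ES_good (alpha i) (A i) (eta i) (H i)) ->
  (forall i, adj (a i) (b i)) ->
  let alpha_max := \big[Num.max/0]_(i < t) alpha i in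
  (exists C : R, 0 < C /\ forall n : nat,
      (ex_glue a b n)%:R <= C * powR (n%:R) (1 + alpha_max))
  /\
  ((forall s1 s2 : 'I_t -> bool, isomorphic (glue a b s1) (glue a b s2)) ->
   exists A0 eta0 : R, 0 < A0 /\ 0 < eta0 /\
     forall sigma : 'I_t -> bool, ES_good alpha_max A0 eta0 (glue a b sigma)).
Proof.
move=> t0 sH al01 A0 eta0 good ab am.
have al0 i : 0 <= alpha i by case/andP: (al01 i).
have [A' [c [A'0 c0 super]]] := glue_supersaturated sH al0 A0 eta0 good ab.
rewrite -/am in super; have am0 : 0 <= am by rewrite /am bigmax_ge_id.
split.
  (* A graph free of all glued graphs with more edges than this would make the supersaturation lower
     bound positive while every copy count is 0. *)
  exists A'; split=> // n; rewrite /ex_glue.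
  elim/big_ind: _ => [|x y hx hy|E /andP[/andP[/forallP irr /forallP sym] /forallP free]].
  - by rewrite mulr_ge0 ?powR_ge0 // ltW.
  - by rewrite /maxn; case: ifP.
  pose G := graph_of_rel E; have nG : nverts G = n by rewrite /nverts card_ord.
  have sG : simple_graph G.
    by split=> [x|x y] /=; [exact: irr|move/forallP: (sym x) => /(_ y)/eqP].
  rewrite leNgt; apply/negP => big; have := super G sG; rewrite nG.
  move/(_ (ltW big)); rewrite [leRHS]big1; last first.
    by move=> sigma _; have := free sigma; rewrite /contains lt0n negbK => /eqP->.
  have n0 : (0 < n)%N.
    case: n => [|//] in E irr sym free G nG sG big *.
    by have := nedges_leq G; rewrite nG => le0; move: big; rewrite (_ : nedges _ = 0%N);
      [rewrite powR0 ?mulr0 ?ltxx // gt_eqF // ltr_pwDl|apply/eqP; rewrite -leqn0].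
  have m0 : 0 < (nedges G)%:R :> R.
    by apply: le_lt_trans big; rewrite mulr_ge0 ?powR_ge0 // ltW.
  apply/negP; rewrite -ltNge mulr_gt0 ?exprn_gt0 ?ltr0n // mulr_gt0 //.
  by rewrite exprn_gt0 // divr_gt0 // exprn_gt0 // ltr0n.
(* The [2 ^ t] choices of [sigma] give isomorphic graphs, so each accounts for an equal share of the
   sum. *)
move=> iso; exists A', (c / (2 ^ t)%:R); split=> //; split.
  by rewrite divr_gt0 // ltr0n expn_gt0.
move=> sigma G sG /=.
(* For the empty host, [p] is a division by zero, hence 0, and its power vanishes because the glued
   graph has an edge. *)
have [n0|n0] := posnP (nverts G).
  have e0 : (0 < nedges (glue a b sigma))%N.
    exact: leq_trans (nedges_glue (fun i => simple_edge_neq (sH i) (ab i)) sigma t0 sH ab).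
  move=> _; rewrite n0 exp0n // invr0 mulr0 expr0n gtn_eqF //.
  by rewrite mulr0 mul0r.
have n0R : 0 < (nverts G)%:R :> R by rewrite ltr0n.
rewrite natrX divfK ?expf_neq0 ?gt_eqF // => /(super G sG) main.
set p := _ / _ in main *.
have nab i := simple_edge_neq (sH i) (ab i).
have p0 : 0 <= p by rewrite divr_ge0 ?exprn_ge0.
have p1 : p <= 1.
  by rewrite ler_pdivrMr ?exprn_gt0 // mul1r -natrX ler_nat nedges_leq.
rewrite -mulrA mulrAC ler_pdivrMr ?ltr0n ?expn_gt0 // mulrA (nverts_glue nab).
apply: (@le_trans _ _ (\sum_(s : {ffun 'I_t -> bool}) (copies (glue a b sigma) G)%:R)).
  (* Since [p <= 1], raising the exponent to the true number of edges only weakens the bound. *)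
  apply: le_trans (le_trans main _).
    rewrite ler_wpM2r ?exprn_ge0 // ler_wpM2l ?(ltW c0) //.
    by apply: ler_wiXn2l => //; apply: nedges_glue.
  by apply: ler_sum => s _; rewrite ler_nat; apply: copies_isomorphic.
by rewrite sumr_const card_ffun card_bool card_ord mulr_natr.
Qed.
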